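(* Let $d\ge 2$ and $n,k\ge 0$ be integers. Then $N_d(n,k)$ equals the number of permutations of $[(d-1)(n-k)+k+1]$ in $\mathcal{P}_d$ with exactly $k+1$ decreasing runs.
   Context: $N_d(n,k) = \frac{1}{n+1} \binom{n+1}{k+1} \binom{ n + (n-k)(d-2)+1}{k}$, and $[m]=\{1,\dots,m\}$. A permutation $P=P_1\cdots P_m$ of $[m]$ contains the pattern $231$ if there are indices $i_1<i_2<i_3$ with $P_{i_3}<P_{i_1}<P_{i_2}$; otherwise it avoids $231$. A decreasing run of $P$ is a maximal sequence of consecutive entries $P_i>P_{i+1}>\cdots>P_j$ (e.g. $314652$ has decreasing runs $31$, $4$, $652$). $\mathcal{P}_d$ is the set of nonempty $231$-avoiding permutations in which every decreasing run has length congruent to $1$ modulo $d-1$. *)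

(* Defs.v *)
From mathcomp Require Import all_boot all_order all_fingroup all_algebra.

Set Implicit Arguments.
Unset Strict Implicit.
Unset Printing Implicit Defensive.

Import GRing.Theory.

(* Binomial coefficient with an integer upper argument; the negative case is
   upper negation, binom(-(a+1), k) = (-1)^k binom(a+k, k). *)
Definition binz (a : int) (k : nat) : rat :=
  match a with
  | Posz a => ('C(a, k)%:R)%R
  | Negz a => ((-1) ^+ k * 'C(a + k, k)%:R)%R
  end.

Definition Nd (d n k : nat) : rat :=
  ((n.+1%:R)^-1 * 'C(n.+1, k.+1)%:R
     * binz (n%:Z + (n%:Z - k%:Z) * (d%:Z - 2) + 1) k)%R.

(* The cardinality of [m] = {1, ..., m}, which is empty when m <= 0. *)
Definition cardZ (m : int) : nat := if m is Posz p then p else 0.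

(* A permutation P of [m] is represented by s : 'S_m, with positions and values
   shifted from {1, ..., m} to {0, ..., m-1}. *)
Section Patterns.

Variables (m : nat) (s : 'S_m).

Definition contains231 : bool :=
  [exists i1 : 'I_m, exists i2 : 'I_m, exists i3 : 'I_m,
    [&& i1 < i2, i2 < i3, s i3 < s i1 & s i1 < s i2]].

(* p = (i, j) stands for the sequence of consecutive entries s i, ..., s j. *)
Definition decreasing_block (p : 'I_m * 'I_m) : bool :=
  (p.1 <= p.2) &&
  [forall a : 'I_m, forall b : 'I_m,
    [&& p.1 <= a, b == a.+1 :> nat & b <= p.2] ==> (s b < s a)].

Definition decreasing_runs : {set 'I_m * 'I_m} :=
  [set p | decreasing_block p &
    [forall q : 'I_m * 'I_m,
      [&& decreasing_block q, q.1 <= p.1 & p.2 <= q.2] ==> (q == p)]].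

Definition run_length (p : 'I_m * 'I_m) : nat := (p.2 - p.1).+1.

Definition in_Pd (d : nat) : bool :=
  [&& 0 < m, ~~ contains231 &
    [forall p in decreasing_runs, run_length p == 1 %[mod d - 1]]].

End Patterns.

(* Main.v *)
Require Import Defs.
From mathcomp Require Import all_boot all_order all_fingroup all_algebra.
From mathcomp Require Import zify ring.

(** A 231-avoiding permutation is exactly one that a stack sorts: push its
    entries in order, and pop whenever the smallest entry not yet output is on
    top. An entry is pushed directly after its predecessor, with no pop in
    between, iff it is smaller, so decreasing runs are the maximal groups of
    consecutive pushes. Put [e = d - 1]. The permutations to be counted
    correspond to push-pop words whose groups of pushes have lengths
    [1 + e * j_i] with [\sum_i j_i = n - k], and by the cycle lemma
    [(1 / (k + 1)) * 'C(m, k) * 'C(n, k)] of these words sort [m] entries with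
    [k + 1] groups. Instead of using the cycle lemma, we generalise this closed
    form to an arbitrary initial stack height and check that it satisfies the
    recurrence given by the next operation. *)

Set Implicit Arguments.
Unset Strict Implicit.
Unset Printing Implicit Defensive.

Import GRing.Theory Num.Theory.

(** * The counting formula *)

(* The number of ordered forests of [q] plane trees with [r] inner nodes, of
   arities [1 + e * j_i] where [\sum_i j_i = w]; for [q > 0] these encode the
   push-pop words that start with [q - 1] entries on the stack. *)
Definition forests (e q r w : nat) : rat :=
  if r is r'.+1 then
    (q%:R / r%:R * 'C(q + r' + e * w, r')%:R * 'C(w + r', w)%:R)%R
  else (nat_of_bool ((w == 0) && (0 < q)))%N%:R%R.

Lemma forests0q e r w : forests e 0 r w = 0%R.
Proof. by case: r => [|r] /=; rewrite ?andbF // !mul0r. Qed.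

(** The left side counts forests whose first tree has an inner root, of arity [1 + e * j]. If
    [j = 0], deleting the root leaves [q.+1] trees; otherwise detaching [e] of its children leaves
    [q.+1 + e] trees, the first still with an inner root, and lowers [w] by one. The proof below
    checks the identity on the closed form. *)
Lemma forests_rec e q r w :
  (forests e q.+1 r.+1 w - forests e q r.+1 w =
   forests e q.+1 r w +
   (if w is w'.+1
    then forests e (q.+1 + e) r.+1 w' - forests e (q + e) r.+1 w' else 0))%R.
Proof.
case: r => [|r].
  case: w => [|w]; rewrite /forests ?andbT !(addn0, bin0, binn, mulr1, divr1, addr0, natrD).
    by rewrite eqxx -natr1 /=; ring.
  by rewrite -(natr1 q) /=; ring.
have ne1 : (r.+1%:R != 0 :> rat)%R by rewrite pnatr_eq0.
have ne2 : (r.+2%:R != 0 :> rat)%R by rewrite pnatr_eq0.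
rewrite /forests.
set N := (q + r + e * w).+1.
(* By Pascal's rule all binomials are expressed through [X], [Y] here and [A], [B] below. The ratios
   [Y / X] and [B / A] are rational functions, so [field] finishes. For [w = 0], [Y = 0] matches the
   missing last term. *)
have [X [Y [X0 [Y0 XY]]]] : exists X Y : rat, 
    [/\ X = ('C(w + r, w))%:R, 
        Y = (if w is w'.+1 then 'C(w' + r.+1, w') else 0)%:R &
        r.+1%:R * Y = w%:R * X]%R.
  exists ('C(w + r, w))%:R%R, (if w is w'.+1 then 'C(w' + r.+1, w') else 0)%:R%R.
  split=> //; case: w {N} => [|w]; rewrite ?mulr0 ?mul0r // -!natrM.
  congr (_%:R)%R; rewrite -addSnnS [RHS]mul_bin_left; congr (_ * _); lia.
have -> : ('C(w + r.+1, w)%:R = X + Y :> rat)%R.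
  rewrite X0 Y0; case: w {N X0 Y0 XY} => [|w]; first by rewrite !bin0 addr0.
  by rewrite addnS binS natrD addSnnS.
have -> : (q.+1 + r.+1 + e * w = N.+1)%N by rewrite /N; lia.
have -> : (q + r.+1 + e * w = N)%N by rewrite /N; lia.
have -> : (q.+1 + r + e * w = N)%N by rewrite /N; lia.
have [A [B [A0 [B0 AB]]]] : exists A B : rat,
    [/\ A = 'C(N, r)%:R, B = 'C(N, r.+1)%:R &
        r.+1%:R * B = (q%:R + 1 + e%:R * w%:R) * A]%R.
  exists 'C(N, r)%:R%R, 'C(N, r.+1)%:R%R; split=> //.
  rewrite natr1 -!natrM -natrD -natrM; congr (_%:R)%R.
  by rewrite mul_bin_left; congr (_ * _); rewrite /N; lia.
have EN : ('C(N.+1, r.+1)%:R = A + B :> rat)%R by rewrite binS natrD A0 B0 addrC.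
rewrite EN -A0 -B0 -X0.
have -> : ((if w is w'.+1
   then (q.+1 + e)%:R / r.+2%:R * 'C(q.+1 + e + r.+1 + e * w', r.+1)%:R * 'C(w' + r.+1, w')%:R
       - (q + e)%:R / r.+2%:R * 'C(q + e + r.+1 + e * w', r.+1)%:R * 'C(w' + r.+1, w')%:R
   else 0)
   = (q.+1 + e)%:R / r.+2%:R * (A + B) * Y - (q + e)%:R / r.+2%:R * B * Y)%R.
  rewrite Y0; case: w @N A0 B0 EN {X0 Y0 XY AB} => [|w] N A0 B0 EN; first by rewrite !mulr0 subr0.
  have -> : (q.+1 + e + r.+1 + e * w = N.+1)%N by rewrite /N; lia.
  have -> : (q + e + r.+1 + e * w = N)%N by rewrite /N; lia.
  by rewrite EN -B0.
have Ev : (B = (q%:R + 1 + e%:R * w%:R) * A / r.+1%:R)%R by rewrite -AB mulrC mulKf.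
have Yv : (Y = w%:R * X / r.+1%:R)%R by rewrite -XY mulrC mulKf.
rewrite Ev Yv.
have -> : (r.+2%:R = r.+1%:R + 1 :> rat)%R by rewrite natr1.
rewrite -natr1 in ne2.
rewrite !natrD.
have -> : (q.+1%:R = q%:R + 1 :> rat)%R by rewrite natr1.
move: r.+1%:R%R ne1 ne2 => c ne1 ne2.
by field; rewrite ne1 ne2.
Qed.

(** * Stack configurations *)

Definition avoids231 (s : seq nat) : Prop :=
  forall a b c, subseq [:: b; c; a] s -> a < b -> b < c -> False.

(** The accumulators [c], the length of the current run so far, and [x], its last entry, allow the
    reading to resume in the middle of a run. *)
Fixpoint run_lengths_from (c x : nat) (s : seq nat) : seq nat :=
  if s is y :: s' then
    if y < x then run_lengths_from c.+1 y s' else c :: run_lengths_from 1 y s'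
  else [:: c].

Definition run_lengths (s : seq nat) : seq nat :=
  if s is x :: s' then run_lengths_from 1 x s' else [::].

Lemma sumn_run_lengths_from c x s :
  sumn (run_lengths_from c x s) = c + size s.
Proof.
elim: s c x => [|y s IH] c x /=; first by rewrite addn0.
by case: ifP => _ /=; rewrite IH; lia.
Qed.

Definition good_runs (e r : nat) (l : seq nat) : bool :=
  (size l == r) && all (fun c => c == 1 %[mod e]) l.

(* [j] is the number of entries that the current run, of length [c] so far,
   still lacks. *)
Lemma good_runs_size e r c j x s :
  j < e -> c + j = 1 %[mod e] -> 0 < c ->
  good_runs e r.+1 (run_lengths_from c x s) -> r + j <= size s.
Proof.
move=> je; elim: s c j x r je => [|y s IH] c j x r je cj c0 /=.
  rewrite /good_runs /= eqSS andbT => /andP[/eqP <- /eqP c1].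
  have /eqP : j = 0 %[mod e] by apply/eqP; rewrite -(eqn_modDl c) addn0 cj c1.
  by rewrite mod0n modn_small // => /eqP->.
case: ifP => _.
  case: j je cj => [|j] je cj H.
    (* A run that goes on past an admissible length lacks [e - 1] entries after the next one. *)
    have := IH c.+1 e.-1 y r _ _ _ H.
    rewrite addSnnS prednK //= modnDr -(addn0 c) cj; lia.
  by have := IH c.+1 j y r _ _ _ H; rewrite addSnnS; lia.
rewrite /good_runs /= eqSS => /and3P[sz /eqP c1 al].
have j0 : j = 0.
  have /eqP : j = 0 %[mod e] by apply/eqP; rewrite -(eqn_modDl c) addn0 cj c1.
  by rewrite mod0n modn_small // => /eqP->.
case: r sz => [|r] sz; first by lia.
have e0 : 0 < e by lia.
by have := IH 1 0 y r e0 erefl erefl; rewrite /good_runs sz al => /(_ isT); lia.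
Qed.

(* [t = (A, B)]: the stack [A], top first, and the entries [B] still to be
   pushed; [v] is the next value to output. *)
Definition stack_state (v q p : nat) (t : seq nat * seq nat) : Prop :=
  [/\ size t.1 = q, size t.2 = p, perm_eq (t.1 ++ t.2) (iota v (q + p)),
      sorted ltn t.1 & avoids231 (catrev t.1 t.2)].

Lemma stack_state_mem v q p A B z :
  stack_state v q p (A, B) -> (z \in A ++ B) = (v <= z < v + (q + p)).
Proof. by case=> _ _ /perm_mem /(_ z) /= -> _ _; rewrite mem_iota. Qed.

(** As [v] occurs only once, every embedding sends the final [v] there, hence [t] to its left. *)
Lemma subseq_rcons_cat_cons (T : eqType) (v : T) t s1 s2 :
  v \notin s1 -> v \notin s2 -> subseq (rcons t v) (s1 ++ v :: s2) ->
  subseq t s1.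
Proof.
move=> + v2; elim: s1 t => [|y s1 IH] [|x t] //=.
  move=> _; case: ifP => _ /mem_subseq /(_ v); rewrite ?inE mem_rcons ?inE eqxx ?orbT.
    by move/(_ isT) => H; rewrite H in v2.
  by move/(_ isT) => H; rewrite H in v2.
rewrite inE negb_or => /andP[_ v1]; case: ifP => _; first exact: IH.
by move/(IH (x :: t) v1).
Qed.

(* Inserting the minimum right after a decreasing prefix creates no 231. *)
Lemma avoids231_insert_min v A B :
  all (ltn v) (A ++ B) -> sorted ltn A ->
  avoids231 (catrev A (v :: B)) <-> avoids231 (catrev A B).
Proof.
rewrite !catrevE => vAB sA; split=> av a b c sub ab bc.
  apply: (av a b c) => //; apply: subseq_trans sub _.
  by apply: cat_subseq => //; apply: subseq_cons.
have vn s : {subset s <= A ++ B} -> v \notin s.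
  move=> sAB; apply/negP => /sAB /(allP vAB); by rewrite /= ltnn.
have vA : v \notin rev A by apply: vn => z; rewrite mem_rev mem_cat => ->.
have vB : v \notin B by apply: vn => z; rewrite mem_cat => ->; rewrite orbT.
have ge z : z \in [:: b; c; a] -> v <= z.
  move/(mem_subseq sub); rewrite mem_cat inE mem_rev => H.
  have [->//|zv] := eqVneq z v; apply: ltnW; apply: (allP vAB).
  by move: H; rewrite (negbTE zv) mem_cat.
have va : v <= a by apply: ge; rewrite !inE eqxx !orbT.
(* If [v] is the smallest entry of the pattern, the two others form an ascent in the decreasing
   [rev A]. Otherwise all three exceed [v] and survive its deletion. *)
have [Ea|av'] := eqVneq a v.
  rewrite Ea in sub; have := subseq_rcons_cat_cons (t := [:: b; c]) vA vB sub.
  move/(subseq_sorted (rev_trans ltn_trans)); rewrite rev_sorted sA => /(_ isT) /=.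
  by rewrite andbT; lia.
apply: (av a b c) => //.
have -> : rev A ++ B = filter (predC1 v) (rev A ++ v :: B).
  rewrite filter_cat /= eqxx /=; congr (_ ++ _); apply/esym/all_filterP/allP => z zs;
  apply/eqP => E; by rewrite -E zs in vA vB.
by rewrite subseq_filter sub /= andbT; lia.
Qed.

(** Since [catrev (v :: A) B] is by computation [catrev A (v :: B)], a pop deletes the minimum right
    after a decreasing prefix. *)
Lemma stack_state_pop v q p A B :
  stack_state v q.+1 p (v :: A, B) <-> stack_state v.+1 q p (A, B).
Proof.
have vAB : perm_eq (A ++ B) (iota v.+1 (q + p)) -> all (ltn v) (A ++ B).
  by move=> /perm_mem pe; apply/allP => z; rewrite pe mem_iota => /andP[].
split=> -[/= sA sB pe so av].
  rewrite /= perm_cons in pe.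
  have so' := path_sorted so.
  split=> //; first by case: sA.
  by apply/(avoids231_insert_min (vAB pe) so').
split=> //=; first by rewrite sA.
- by rewrite perm_cons.
- rewrite path_min_sorted //; apply/allP => z zA; apply: (allP (vAB pe)).
  by rewrite mem_cat zA.
- exact/(avoids231_insert_min (vAB pe) so).
Qed.

(** A push leaves the underlying sequence [catrev A (y :: B)] unchanged; only the order on the stack
    is a new condition. *)
Lemma stack_state_push v q p y A B :
  stack_state v q.+1 p (y :: A, B) <->
  stack_state v q p.+1 (A, y :: B) /\ path ltn y A.
Proof.
have pe : perm_eq (y :: A ++ B) (A ++ y :: B).
  by rewrite -cat1s -[y :: B]cat1s perm_catCA.
split=> [[/= sA sB pe' so av]|[[/= sA sB pe' so av] yA]].
  split=> //; split=> //=; [by case: sA | by rewrite sB | | exact: path_sorted so].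
  by rewrite addnS -(permPl pe).
split=> //=; [by rewrite sA | by case: sB |].
by rewrite (permPl pe) -addSnnS in pe' *.
Qed.

(* If [v] is not on top and the next entry [y] exceeds the top [x], then
   [x, y, v] is a 231. *)
Lemma stack_state_pop_or_push v q p A B :
  0 < q + p -> stack_state v q p (A, B) ->
  (exists A', A = v :: A') \/ (exists y B', B = y :: B' /\ path ltn y A).
Proof.
move=> qp st; have m z := stack_state_mem z st.
case: st => /= sA sB pe so av.
case: A => [|x A] in sA pe so av m *.
  by case: B => [|y B] in sB pe av m *; [rewrite -sA -sB in qp | right; exists y, B].
have [->|xv] := eqVneq x v; first by left; exists A.
have vx : v < x by have := m x; rewrite inE eqxx /= => /esym /andP[+ _]; rewrite leq_eqVlt eq_sym (negbTE xv).
have /orP[vA|vB] : (v \in A) || (v \in B).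
  have := m v; have -> : v <= v < v + (q + p) by lia.
  by rewrite inE eq_sym (negbTE xv) mem_cat.
  have /allP /(_ v vA) /= := order_path_min ltn_trans so; lia.
case: B => [|y B] // in sB pe av m vB *.
have [yx|xy] := ltnP y x; first by right; exists y, B; rewrite /= yx.
have {}xy : x < y.
  rewrite ltn_neqAle xy andbT; apply/eqP => E.
  have : uniq ((x :: A) ++ y :: B) by rewrite (perm_uniq pe) iota_uniq.
  by rewrite E /= mem_cat inE eqxx !orbT.
case: (av v x y) => //; rewrite catrevE rev_cons cat_rcons.
apply: (@subseq_trans _ [:: x, y & B]); last exact: suffix_subseq.
rewrite /= !eqxx sub1seq; move: vB; rewrite inE; case: eqP => // E; lia.
Qed.

(** * Counting configurations *)

(** Configurations do not form a finite type, so an enumeration witnesses the count. The value is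
    rational to match [forests], which spares a proof of integrality. *)
Definition has_card (T : eqType) (C : T -> Prop) (x : rat) : Prop :=
  exists E : seq T,
    [/\ uniq E, forall t, t \in E <-> C t & (size E)%:R%R = x].

Lemma eq_has_card (T : eqType) (C D : T -> Prop) x :
  (forall t, C t <-> D t) -> has_card C x -> has_card D x.
Proof.
by move=> CD [E [uE EC sE]]; exists E; split=> // t; rewrite -CD.
Qed.

Lemma has_card0 (T : eqType) (C : T -> Prop) :
  (forall t, ~ C t) -> has_card C 0%R.
Proof. by move=> nC; exists [::]; split=> // t; split=> // /nC. Qed.

Lemma has_cardU (T : eqType) (C C1 C2 : T -> Prop) (f1 f2 : T -> T) x1 x2 :
  has_card C1 x1 -> has_card C2 x2 ->
  (forall t u, C1 t -> C1 u -> f1 t = f1 u -> t = u) ->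
  (forall t u, C2 t -> C2 u -> f2 t = f2 u -> t = u) ->
  (forall t u, C1 t -> C2 u -> f1 t <> f2 u) ->
  (forall t, C t <->
     (exists2 u, C1 u & t = f1 u) \/ (exists2 u, C2 u & t = f2 u)) ->
  has_card C (x1 + x2)%R.
Proof.
move=> [E1 [u1 EC1 <-]] [E2 [u2 EC2 <-]] inj1 inj2 dis CE.
exists (map f1 E1 ++ map f2 E2); split.
- rewrite cat_uniq; apply/and3P; split.
  + by rewrite map_inj_in_uniq // => t u /EC1 Ct /EC1; apply: inj1.
  + apply/hasPn => _ /mapP[u /EC2 Cu ->]; apply/negP => /mapP[t /EC1 Ct /esym].
    exact: dis.
  + by rewrite map_inj_in_uniq // => t u /EC2 Ct /EC2; apply: inj2.
- move=> t; rewrite mem_cat CE; split.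
    by case/orP => /mapP[u]; [move/EC1 => Cu ->; left | move/EC2 => Cu ->; right];
       exists u.
  by case=> -[u Cu ->]; apply/orP; [left; apply/map_f/EC1 | right; apply/map_f/EC2].
- by rewrite size_cat !size_map natrD.
Qed.

Definition unpop (v : nat) (t : seq nat * seq nat) := (v :: t.1, t.2).
Definition unpush (t : seq nat * seq nat) := (behead t.1, head 0 t.1 :: t.2).

(** The next operation is determined: with the minimum [v] on top, no smaller entry is left to push,
    and otherwise a push must follow. The guards [0 < q] and [0 < p] empty the branch whose
    predecessor would be truncated. *)
Lemma has_card_stack_state v q p (Q : seq nat * seq nat -> Prop) x1 x2 :
  0 < q + p ->
  has_card (fun t => 0 < q /\ stack_state v.+1 q.-1 p t /\ Q (unpop v t)) x1 ->
  has_card (fun t => 0 < p /\ stack_state v q.+1 p.-1 t /\ Q (unpush t)) x2 ->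
  has_card (fun t => stack_state v q p t /\ Q t) (x1 + x2)%R.
Proof.
move=> qp h1 h2; apply: (has_cardU (f1 := unpop v) (f2 := unpush)) h1 h2 _ _ _ _.
- by move=> [A B] [A' B'] _ _ [-> ->].
- by move=> [[|x A] B] [[|y A'] B'] [_ [[]]] // + _ _ _ _ _ [_ [[]]] // _ _ _ _ _ _ [-> -> ->].
- move=> [A B] [[|y A'] B'] _ [p0 [st _]] [EA EB]; first by case: st.
  have [st' +] := (stack_state_push v q p.-1 y A' B').1 st.
  rewrite -EA /= => /andP[yv _].
  by have := stack_state_mem y st; rewrite inE eqxx /=; lia.
move=> [A B]; split.
  case=> st Qt; have [[A' EA]|[y [B' [EB yA]]]] := stack_state_pop_or_push qp st; subst.
    left; exists (A', B) => //; have sA : size (v :: A') = q by case: st.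
    case: q => // q in sA qp st *.
    by split=> //; split=> //; apply/stack_state_pop.
  right; exists (y :: A, B') => //; have sB : size (y :: B') = p by case: st.
  case: p => // p in sB qp st *.
  by split=> //; split=> //; apply/stack_state_push.
case=> -[[A' B'] [qp0 [st Qt]] ->]; split=> //.
  by case: q => // q in qp qp0 st *; apply/stack_state_pop.
case: A' => [|y A'] in st Qt *; first by case: st.
by case: p => // p in qp qp0 st *; case/stack_state_push: st.
Qed.

Lemma run_lengths_from_min c v s :
  all (ltn v) s -> run_lengths_from c v s = c :: run_lengths s.
Proof. by case: s => [|y s] //= /andP[vy _]; rewrite ltnNge ltnW. Qed.

(** For use at the start or after a pop: the last entry read is then already output, hence smaller
    than the next one, which opens a new run. *)
Definition outside_run e r (t : seq nat * seq nat) : Prop :=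
  good_runs e r (run_lengths t.2).

(** For use right after a push, when the last entry read is on top of the stack; [r] includes the
    current run. *)
Definition inside_run e r c (t : seq nat * seq nat) : Prop :=
  good_runs e r (run_lengths_from c (head 0 t.1) t.2).

(** The popped minimum is below every entry still to come, so the current run ends with it. *)
Lemma inside_run_pop e r c v q p t : stack_state v.+1 q p t ->
  inside_run e r.+1 c (unpop v t) <-> c = 1 %[mod e] /\ outside_run e r t.
Proof.
case: t => A B st; rewrite /inside_run /= run_lengths_from_min.
  rewrite /outside_run /good_runs /= eqSS; split.
    by move=> /and3P[-> /eqP -> ->].
  by move=> [/eqP -> /andP[-> ->]].
apply/allP => z zB; have := stack_state_mem z st.
by rewrite mem_cat zB orbT => /esym /andP[].
Qed.

Lemma inside_run_push e r c v q p t : stack_state v q.+2 p t ->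
  inside_run e r c (unpush t) <-> inside_run e r c.+1 t.
Proof.
case: t => [[|y [|x A]] B] // [] //= _ _ _ /andP[yx _] _.
by rewrite /inside_run /= yx.
Qed.

(* In the second count the current run has length [c], and [j] more pushes are
   needed before it may be closed by a pop. *)
Lemma has_card_runs e N : 0 < e ->
  (forall v q r w, q + (r + e * w).*2 <= N ->
     has_card (fun t => stack_state v q (r + e * w) t /\ outside_run e r t)
       (forests e q.+1 r w)) /\
  (forall v q r w j c, j < e -> c + j = 1 %[mod e] -> 0 < c ->
     q.+1 + (r + e * w + j).*2 <= N ->
     has_card
       (fun t => stack_state v q.+1 (r + e * w + j) t /\ inside_run e r.+1 c t)
       (forests e (q + j).+1 r.+1 w - forests e (q + j) r.+1 w)%R).
Proof.
(* [N] bounds the number of operations left: one pop for each entry on the stack, a push and a pop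
   for each other entry. *)
move=> e0; elim: N => [|N [IH1 IH2]].
  split=> // v [|q] // r w; rewrite add0n leqn0 double_eq0 addn_eq0 muln_eq0.
  rewrite (gtn_eqF e0) /= => /andP[/eqP-> /eqP->]; rewrite muln0.
  exists [:: ([::], [::])]; split=> // -[A B]; rewrite inE; split.
    move/eqP=> [-> ->]; split=> //; split=> // a b c /=.
  by case=> -[/= /size0nil -> /size0nil ->].
split=> [v q r w HN|v q r w j c je cj c0 HN].
  have [/eqP|qp] := posnP (q + (r + e * w)).
    rewrite !addn_eq0 muln_eq0 (gtn_eqF e0) /= => /and3P[/eqP-> /eqP-> /eqP->].
    by apply: IH1; rewrite muln0.
  case: r => [|r] in HN qp *.
    (* With no run left nothing may remain to be pushed: if [w = 0] the next operation is a pop, and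
       [w > 0] is impossible. *)
    have [w0|w0] := posnP w.
      subst w.
      rewrite muln0 addn0 in HN qp *; have -> : forests e q.+1 0 0 = (forests e q 0 0 + 0)%R.
        by case: q qp {HN} => // q _; rewrite addr0.
      apply: has_card_stack_state => //; last by apply: has_card0 => t [].
      case: q => [|q] // in HN qp *.
      have /IH1 : q + (0 + e * 0).*2 <= N by lia.
      move/(_ v.+1); rewrite muln0; apply: eq_has_card => t; split; last by case.
      by move=> [st ok]; split.
    have -> : forests e q.+1 0 w = 0%R by case: w w0 {HN qp}.
    apply: has_card0 => -[A [|y B]] [[/= _ sB _ _ _]].
      by move/eqP: sB; rewrite eq_sym muln_eq0; lia.
    rewrite /outside_run /good_runs /= => /andP[/nilP E _].
    by have := sumn_run_lengths_from 1 y B; rewrite E.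
  (* The first summand counts a pop; the difference is the inside-run count for [c = 1] and [j = 0],
     reached by a push. *)
  have -> : forests e q.+1 r.+1 w =
     (forests e q r.+1 w + (forests e q.+1 r.+1 w - forests e q r.+1 w))%R by ring.
  apply: has_card_stack_state => //.
    case: q => [|q] in HN qp *; first by rewrite forests0q; apply: has_card0 => t [].
    have /IH1 : q + (r.+1 + e * w).*2 <= N by lia.
    move/(_ v.+1); apply: eq_has_card => t; split; last by case=> _.
    by move=> [st ok]; split.
  have /(IH2 v) : q.+1 + (r + e * w + 0).*2 <= N by lia.
  move/(_ 1 e0 erefl erefl); rewrite !addn0; apply: eq_has_card => t.
  by split=> [[]|[_ []]].
(* While entries are lacking, a pop would close the run at a forbidden length. The push is forced
   and keeps [q + j] constant. *)
case: j => [|j] in je cj HN *; last first.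
  rewrite -[(_ - _)%R]add0r; apply: has_card_stack_state; first by lia.
    apply: has_card0 => t [_ [st /(inside_run_pop _ _ _ st)[c1 _]]].
    have : j.+1 = 0 %[mod e] by apply/eqP; rewrite -(eqn_modDl c) addn0 cj c1.
    by rewrite mod0n modn_small.
  have /(IH2 v q.+1 r w j c.+1) : q.+2 + (r + e * w + j).*2 <= N by lia.
  rewrite addSnnS => /(_ (ltnW je) cj isT); rewrite addSnnS.
  rewrite [X in 0 < X]addnS [X in X.-1]addnS.
  apply: eq_has_card => t; split=> [[st ok]|[_ [st /(inside_run_push _ _ _ st)]]] //.
  by do 2!split=> //; apply/(inside_run_push _ _ _ st).
(* Now the run may end: the two terms of [forests_rec] are the pop that closes it and the push that
   commits it to [e] more entries. *)
rewrite !addn0 in cj HN *; rewrite forests_rec.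
apply: has_card_stack_state; first by lia.
  have /(IH1 v.+1) : q + (r + e * w).*2 <= N by lia.
  apply: eq_has_card => t; split=> [[st ok]|[_ [st /(inside_run_pop _ _ _ st)[_]]]] //.
  by do 2!split=> //; apply/(inside_run_pop _ _ _ st).
(* For [w = 0] only [r] entries remain, one for each later run, so the current run cannot be
   extended. *)
case: w => [|w] in HN *.
  apply: has_card0 => t [p0 [st /(inside_run_push _ _ _ st)]].
  have cj' : c.+1 + e.-1 = 1 %[mod e] by rewrite addSnnS prednK // modnDr.
  have e1 : e.-1 < e by rewrite prednK.
  move/(good_runs_size e1 cj' isT); case: st => _ -> _ _ _; lia.
have /(IH2 v q.+1 r w e.-1 c.+1) : q.+2 + (r + e * w + e.-1).*2 <= N by lia.
rewrite prednK // leqnn addSnnS prednK // modnDr cj => /(_ isT erefl isT).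
have -> : q.+1 + e.-1 = q + e by lia.
rewrite -addSn; have -> : (r + e * w.+1).-1 = r + e * w + e.-1 by lia.
apply: eq_has_card => t; split=> [[st ok]|[_ [st /(inside_run_push _ _ _ st)]]] //.
split; first by lia.
split=> //; exact/(inside_run_push _ _ _ st).
Qed.

(** * Decreasing runs and words of permutations *)

Definition descent (P : seq nat) (l : nat) : bool := nth 0 P l.+1 < nth 0 P l.

(** The guards matter: at the last position [descent] compares with the default [0], and at position
    [0] the predecessor is truncated. *)
Definition maximal_run (P : seq nat) (p : nat * nat) : Prop :=
  [/\ p.1 <= p.2, p.2 < size P, forall l, p.1 <= l < p.2 -> descent P l,
      0 < p.1 -> ~~ descent P p.1.-1 & p.2.+1 < size P -> ~~ descent P p.2].

(* The run being read starts at position [a], and its last entry so far is [x],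
   at position [b]. *)
Fixpoint run_spans_from (a b x : nat) (s : seq nat) : seq (nat * nat) :=
  if s is y :: s' then
    if y < x then run_spans_from a b.+1 y s'
    else (a, b) :: run_spans_from b.+1 b.+1 y s'
  else [:: (a, b)].

Lemma run_lengths_spans a b x s : a <= b ->
  [seq (p.2 - p.1).+1 | p <- run_spans_from a b x s] =
  run_lengths_from (b - a).+1 x s.
Proof.
elim: s a b x => [|y s IH] a b x ab //=; case: ifP => _ /=.
  by rewrite IH ?subSn // ltnW.
by rewrite IH // subnn.
Qed.

Lemma run_spans_start a b x s (p : nat * nat) :
  a <= b -> p \in run_spans_from a b x s -> a <= p.1.
Proof.
elim: s a b x => [|y s IH] a b x ab /=; first by rewrite inE => /eqP->.
case: ifP => _; first by apply: IH; rewrite ltnW.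
by rewrite inE => /orP[/eqP-> //|/(IH _ _ _ (leqnn _))/ltnW]; apply: leq_trans.
Qed.

Lemma run_spans_uniq a b x s : a <= b -> uniq (run_spans_from a b x s).
Proof.
elim: s a b x => [|y s IH] a b x ab //=; case: ifP => _ /=.
  by apply: IH; rewrite ltnW.
rewrite IH // andbT; apply/negP => /run_spans_start /=; lia.
Qed.

Lemma mem_run_spans P a b x s (p : nat * nat) :
  drop b P = x :: s -> a <= b -> (forall l, a <= l < b -> descent P l) ->
  (0 < a -> ~~ descent P a.-1) ->
  p \in run_spans_from a b x s <-> maximal_run P p /\ a <= p.1.
Proof.
(* A maximal run that starts inside the maximal run [(a', b')] equals it, since otherwise an end of
   one would be a descent inside the other. *)
have key a' b' : a' <= b' < size P -> (forall l, a' <= l < b' -> descent P l) ->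
    (0 < a' -> ~~ descent P a'.-1) -> (b'.+1 < size P -> ~~ descent P b') ->
    p = (a', b') <-> maximal_run P p /\ a' <= p.1 <= b'.
  move=> /andP[ab bP] des da db; split=> [->|].
    by split; [split | rewrite /= leqnn].
  case: p => i j [[/= ij jP dij di dj] /andP[ai ib]].
  have Ei : i = a'.
    apply/eqP; rewrite eqn_leq ai andbT leqNgt; apply/negP => lt.
    have /negP := di (leq_ltn_trans (leq0n _) lt); apply; apply: des; lia.
  have Ej1 : b' <= j.
    rewrite leqNgt; apply/negP => lt.
    have /negP := dj (leq_ltn_trans lt bP); apply; apply: des; lia.
  have Ej2 : j <= b'.
    rewrite leqNgt; apply/negP => lt.
    have /negP := db (leq_ltn_trans lt jP); apply; apply: dij; lia.
  by rewrite Ei; congr (_, _); lia.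
elim: s a b x => [|y s IH] a b x dr ab des da /=.
  have sz : size P = b.+1 by have := size_drop b P; rewrite dr /=; lia.
  rewrite inE; split.
    move/eqP; rewrite key ?sz ?leqnn ?ab //; last by rewrite ltnn.
    by case=> ? /andP[].
  move=> [mr ap]; apply/eqP; rewrite key ?sz ?leqnn ?ab //; last by rewrite ltnn.
  by split=> //; rewrite ap; case: mr; rewrite sz; lia.
have sz : b.+1 < size P by have := size_drop b P; rewrite dr /=; lia.
have dr' : drop b.+1 P = y :: s by rewrite -addn1 addnC -drop_drop dr /= ?drop0.
have dE : descent P b = (y < x).
  have Ey : nth 0 P b.+1 = y by rewrite -[b.+1]addn0 -nth_drop dr'.
  have Ex : nth 0 P b = x by rewrite -[b]addn0 -nth_drop dr.
  by rewrite /descent Ey Ex.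
case: ifP => yx.
  apply: IH => //; first exact: ltnW.
  move=> l /andP[al lb]; have [->|ne] := eqVneq l b; first by rewrite dE.
  by apply: des; lia.
have keyb : p = (a, b) <-> maximal_run P p /\ a <= p.1 <= b.
  by apply: key => //; [lia | rewrite dE yx].
have IHb : p \in run_spans_from b.+1 b.+1 y s <-> maximal_run P p /\ b < p.1.
  by apply: IH => // [l|_]; [lia | rewrite dE yx].
rewrite inE; split.
  by case/orP => [/eqP /keyb[mr /andP[]]|/IHb[mr lt]] //; split=> //; lia.
move=> [mr ap]; apply/orP; case: (leqP p.1 b) => pb; last by right; apply/IHb.
by left; apply/eqP/keyb; rewrite ap.
Qed.

Section Words.

Variable m : nat.
Implicit Type s : 'S_m.

Definition word s : seq nat := [seq val (s i) | i <- enum 'I_m].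

Lemma size_word s : size (word s) = m.
Proof. by rewrite size_map size_enum_ord. Qed.

Lemma nth_word s (i : 'I_m) : nth 0 (word s) i = s i.
Proof. by rewrite (nth_map i) ?size_enum_ord // nth_ord_enum. Qed.

Lemma word_inj : injective word.
Proof.
by move=> s t E; apply/permP => i; apply: val_inj; rewrite /= -!nth_word E.
Qed.

Lemma perm_word s : perm_eq (word s) (iota 0 m).
Proof.
rewrite -val_enum_ord /word (map_comp val s); apply: perm_map.
apply: uniq_perm; rewrite ?(map_inj_uniq perm_inj) ?enum_uniq // => i.
by rewrite mem_enum -[i](permKV s) mem_map ?mem_enum //; apply: perm_inj.
Qed.

Lemma word_surj P : perm_eq P (iota 0 m) -> exists s, word s = P.
Proof.
move=> pe; have szP : size P = m by rewrite (perm_size pe) size_iota.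
have lt (i : 'I_m) : nth 0 P i < m.
  have : nth 0 P i \in P by rewrite mem_nth ?szP.
  by rewrite (perm_mem pe) mem_iota.
have inj : injective (fun i => Ordinal (lt i)).
  move=> i j /(congr1 val) /= /eqP; rewrite nth_uniq ?szP //.
    by move/eqP/val_inj.
  by rewrite (perm_uniq pe) iota_uniq.
exists (perm inj); apply: (@eq_from_nth _ 0); rewrite size_word ?szP // => i im.
by rewrite (nth_word _ (Ordinal im)) permE.
Qed.

Lemma subseq_enum_ord3 (i j l : 'I_m) :
  i < j -> j < l -> subseq [:: i; j; l] (enum 'I_m).
Proof.
move=> ij jl; have -> : [:: i; j; l] = [seq x <- enum 'I_m | x \in [:: i; j; l]].
  apply: (inj_map val_inj); apply: (irr_sorted_eq ltn_trans ltnn).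
  - by rewrite /= ij jl.
  - rewrite sorted_map; apply: sorted_filter.
      by move=> a b c; apply: ltn_trans.
    by rewrite -sorted_map val_enum_ord iota_ltn_sorted.
  move=> x; apply/mapP/mapP => -[y yi ->]; exists y => //.
    by rewrite mem_filter yi mem_enum.
  by move: yi; rewrite mem_filter => /andP[].
exact: filter_subseq.
Qed.

Lemma contains231P s : ~~ contains231 s <-> avoids231 (word s).
Proof.
split.
  move=> nc a b c sub ab bc; case/negP: nc.
  have /subseqP[msk szm E] := sub.
  rewrite /word -map_mask in E.
  have so : sorted ltn (map val (mask msk (enum 'I_m))).
    apply: (subseq_sorted ltn_trans) (iota_ltn_sorted 0 m).
    by rewrite -val_enum_ord; apply: map_subseq; apply: mask_subseq.
  move: E so; case: (mask _ _) => [|i1 [|i2 [|i3 []]]] //= [Eb Ec Ea] /and3P[lt1 lt2 _].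
  apply/existsP; exists i1; apply/existsP; exists i2; apply/existsP; exists i3.
  by rewrite lt1 lt2 -Ea -Eb -Ec ab bc.
move=> av; apply/negP => /existsP[i1 /existsP[i2 /existsP[i3 /and4P[l12 l23 ab bc]]]].
by apply: (av _ _ _ _ ab bc); apply: (map_subseq _ (subseq_enum_ord3 l12 l23)).
Qed.

Lemma decreasing_blockP s p :
  decreasing_block s p <->
  p.1 <= p.2 /\ (forall l, p.1 <= l < p.2 -> descent (word s) l).
Proof.
case: p => i j; split=> [/andP[/= ij /forallP H]|[/= ij H]].
  split=> // l /andP[il lj].
  have lm' : l.+1 < m by apply: leq_ltn_trans lj (ltn_ord j).
  have /forallP /(_ (Ordinal lm')) := H (Ordinal (ltnW lm')).
  rewrite /= il lj eqxx /= /descent.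
  by rewrite (nth_word s (Ordinal lm')) (nth_word s (Ordinal (ltnW lm'))).
rewrite /decreasing_block /= ij; apply/forallP => a; apply/forallP => b.
apply/implyP => /and3P[ia /eqP ba bj].
have := H a; rewrite /descent -ba !nth_word; apply; lia.
Qed.

(** Maximality among all blocks reduces to extensions by one entry: a strictly larger block contains
    a descent just before or just after [p]. *)
Lemma decreasing_runsP s p :
  p \in decreasing_runs s <-> maximal_run (word s) (val p.1, val p.2).
Proof.
case: p => i j; rewrite inE; split=> [/andP[/decreasing_blockP[/= ij H] /forallP mx]|].
  split=> //=; first by rewrite size_word.
    move=> i0; apply/negP => di.
    have lm' : i.-1 < m by apply: leq_ltn_trans (leq_pred i) (ltn_ord i).
    have /implyP /(_ _) := mx (Ordinal lm', j).
    rewrite /= leq_pred leqnn !andbT => /(_ _)/eqP E.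
    have [] : (Ordinal lm', j) = (i, j); last by move/(congr1 val) => /=; lia.
    apply: E; apply/decreasing_blockP; split=> /=; first by lia.
    move=> l /andP[il lj]; have [->//|ne] := eqVneq l i.-1; apply: H; lia.
  rewrite size_word => jm; apply/negP => dj.
  have /implyP := mx (i, Ordinal jm).
  rewrite /= leqnn leqnSn !andbT => E.
  have [] : (i, Ordinal jm) = (i, j); last by move/(congr1 val) => /=; lia.
  apply/eqP/E/decreasing_blockP; split=> /=; first by lia.
  move=> l /andP[il lj]; have [->//|ne] := eqVneq l j; apply: H; lia.
move=> [/= ij jm H di dj]; apply/andP; split; first exact/decreasing_blockP.
apply/forallP => -[i' j']; apply/implyP => /= /and3P[/decreasing_blockP[/= ij' H'] ii jj].
apply/eqP; congr (_, _); apply: val_inj => /=; apply/eqP; rewrite eqn_leq ?ii ?jj ?andbT.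
  rewrite leqNgt; apply/negP => lt.
  have /negP := di (leq_ltn_trans (leq0n _) lt); apply; apply: H'; lia.
rewrite leqNgt; apply/negP => lt.
have jm' : j.+1 < size (word s) by rewrite size_word; apply: leq_ltn_trans lt (ltn_ord j').
by have /negP := dj jm'; apply; apply: H'; lia.
Qed.

(** The set [decreasing_runs s] and the scan of [word s] list the same spans, each once, so the
    number and lengths of the runs agree. *)
Lemma good_runsE e r s : 0 < m ->
  good_runs e r (run_lengths (word s)) =
  (#|decreasing_runs s| == r) &&
  [forall p in decreasing_runs s, run_length p == 1 %[mod e]].
Proof.
move=> m0; case Ew : (word s) => [|x B]; first by move: (size_word s); rewrite Ew /=; lia.
pose f (p : 'I_m * 'I_m) := (val p.1, val p.2).
have f_inj : injective f by move=> [i j] [i' j'] [/val_inj-> /val_inj->].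
have pe : perm_eq (map f (enum (decreasing_runs s))) (run_spans_from 0 0 x B).
  apply: uniq_perm; rewrite ?run_spans_uniq ?(map_inj_uniq f_inj) ?enum_uniq //.
  have dr : drop 0 (word s) = x :: B by rewrite drop0 Ew.
  have mem p := mem_run_spans p dr (leqnn 0).
  have mem' p : p \in run_spans_from 0 0 x B <-> maximal_run (word s) p.
    by split=> [/mem[] // [] //|mr]; apply/mem => //; split.
  move=> p; apply/mapP/idP => [[q qr ->]|/mem' mr].
    by apply/mem'/decreasing_runsP; rewrite mem_enum in qr.
  case: p mr => i j mr.
  have jm : j < m by case: mr; rewrite size_word.
  have im : i < m by apply: leq_ltn_trans jm; case: mr.
  exists (Ordinal im, Ordinal jm) => //; rewrite mem_enum; exact/decreasing_runsP.
rewrite /= -(@run_lengths_spans 0 0) // /good_runs size_map all_map.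
rewrite -(perm_size pe) -(perm_all _ pe) size_map -cardE all_map.
congr (_ && _); apply/allP/forallP => H p.
  by apply/implyP => pr; apply: (H p); rewrite mem_enum.
by rewrite mem_enum => pr; have /implyP := H p; apply.
Qed.

End Words.

(** * ** * Counting the permutations *)

Lemma card_in_Pd d k w m : 2 <= d -> m = k.+1 + (d - 1) * w ->
  (#|[set s : 'S_m | in_Pd s d & #|decreasing_runs s| == k.+1]|%:R
   = forests (d - 1) 1 k.+1 w)%R.
Proof.
move=> d2 Em; have e0 : 0 < d - 1 by lia.
have m0 : 0 < m by lia.
have [+ _] := has_card_runs (0 + m.*2) e0.
(* A permutation is a configuration with empty stack and next output [0]. *)
move/(_ 0 0 k.+1 w); rewrite -Em => /(_ (leqnn _)) [E [uE mE <-]].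
set S := [set s | _]; congr (_%:R)%R; rewrite cardE.
pose g (s : 'S_m) : seq nat * seq nat := ([::], word s).
have g_inj : injective g by move=> s t [] /word_inj.
rewrite -(size_map g); apply: perm_size; apply: uniq_perm => //.
  by rewrite (map_inj_uniq g_inj) enum_uniq.
have inS s : s \in S <-> avoids231 (word s) /\ good_runs (d - 1) k.+1 (run_lengths (word s)).
  rewrite inE /in_Pd m0 /= good_runsE // -contains231P.
  split; first by move=> /andP[/andP[-> ->] ->].
  by move=> [-> /andP[-> ->]].
move=> t; apply/mapP/idP => [[s + ->]|/mE].
  rewrite mem_enum => /inS[av ok]; apply/mE; split=> //; split=> //=.
    exact: size_word.
  exact: perm_word.
case: t => A P [[/= /size0nil-> sP pe _ av] ok].
have [s Es] := word_surj pe; exists s; last by rewrite /g Es.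
by rewrite mem_enum; apply/inS; rewrite Es.
Qed.

(** Distinct maximal runs start at distinct positions. *)
Lemma card_decreasing_runs m (s : 'S_m) : #|decreasing_runs s| <= m.
Proof.
rewrite -[X in _ <= X]card_ord.
rewrite -(card_in_imset (f := fst) (D := decreasing_runs s)); first exact: max_card.
move=> [i j] [i' j'] /decreasing_runsP[/= ij jm H _ dj].
move=> /decreasing_runsP[/= ij' jm' H' _ dj'] Ei; subst i'.
suff -> : j = j' by [].
apply: ord_inj; apply/eqP; rewrite eqn_leq.
apply/andP; split; rewrite leqNgt; apply/negP => lt.
  by have /negP := dj' (leq_ltn_trans lt jm); apply; apply: H; lia.
by have /negP := dj (leq_ltn_trans lt jm'); apply; apply: H'; lia.
Qed.

Theorem theorem3p4 (d n k : nat) (hd : 2 <= d) :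
  Nd d n k =
  (#|[set s : 'S_(cardZ ((d%:Z - 1) * (n%:Z - k%:Z) + k%:Z + 1)%R) |
       in_Pd s d & #|decreasing_runs s| == k.+1]|%:R)%R.
Proof.
(* For [n < k] the factor ['C(n.+1, k.+1)] vanishes, and at most [k] entries cannot form [k + 1]
   runs. *)
have [nk|kn] := ltnP n k.
  rewrite /Nd bin_small // mulr0 mul0r.
  set m := cardZ _.
  have mk : m <= k.
    rewrite /m; set x := (_ + 1)%R.
    have : (x <= k%:Z)%R by rewrite /x; nia.
    by case: x => //= x; lia.
  rewrite (_ : [set s | _] = set0) ?cards0 //; apply/setP => s; rewrite !inE.
  apply/negP => /andP[_ /eqP E]; have := card_decreasing_runs s; lia.
have [w En] : exists w, n = k + w by exists (n - k); rewrite subnKC.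
subst n; set z := (_ + 1)%R.
have Ez : z = Posz (k.+1 + (d - 1) * w) by rewrite /z; nia.
rewrite (card_in_Pd (w := w)) ?Ez // /Nd.
(* For [n = k + w] the upper argument of [binz] is the size of the permutations. *)
rewrite (_ : (_ + 1)%R = Posz (k.+1 + (d - 1) * w)); last by nia.
rewrite /forests /binz.
have nz j : (j.+1%:R != 0 :> rat)%R by rewrite pnatr_eq0.
(* Absorption and symmetry trade the factor [1 / (n + 1)] for the [1 / (k + 1)] of [forests]. *)
have -> : ('C((k + w).+1, k.+1)%:R = (k + w).+1%:R * 'C(w + k, w)%:R / k.+1%:R :> rat)%R.
  apply: (canRL (mulfK (nz _))); rewrite -!natrM mulnC -mul_bin_diag; congr (_ * _)%:R%R.
  by rewrite addnC -[in RHS]bin_sub ?leq_addr // addKn.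
rewrite !mulrA mulVf // !mul1r add1n.
ring.
Qed.
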